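(* Let $E$ be a fixed class. A list algebra (over $E$) is initial if and only if it is both minimal and unambiguous.
   Context: Let $E$ be a fixed class (a set or a proper class). A list algebra is a triple $(X,f,x_0)$ with $X$ a class, $f : E \times X \to X$ a mapping and $x_0$ an element of $X$. For $e \in E$ let $f_e : X \to X$ be the mapping $f_e(x) = f(e,x)$. A subclass $X_0$ of $X$ is $f$-invariant if $f_e(X_0) \subset X_0$ for all $e \in E$. The list algebra $(X,f,x_0)$ is minimal if $X$ itself is the only $f$-invariant subclass of $X$ containing $x_0$. It is unambiguous if $f_e$ is injective for each $e \in E$, the classes $f_e(X)$, $e \in E$, are (pairwise) disjoint, and $x_0 \notin \bigcup_{e \in E} f_e(X)$. A morphism $\pi : (X,f,x_0) \to (Y,g,y_0)$ of list algebras is a mapping $\pi : X \to Y$ with $\pi(x_0) = y_0$ and $g_e \circ \pi = \pi \circ f_e$ for all $e \in E$. A list algebra $(X,f,x_0)$ is initial if for each list algebra $(Y,g,y_0)$ there exists a unique morphism $(X,f,x_0) \to (Y,g,y_0)$. *)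

(* Defs.v *)
From mathcomp Require Import all_boot.
From mathcomp Require Import boolp classical_sets.

Set Implicit Arguments.
Unset Strict Implicit.
Unset Printing Implicit Defensive.

Local Open Scope classical_set_scope.

(** Classes are rendered as types, and subclasses of [X] as elements of
    [set X], i.e. predicates [X -> Prop]. *)

Record listAlgebra (E : Type) := ListAlgebra {
  carrier :> Type;
  op : E * carrier -> carrier;
  base : carrier
}.

Definition op_at (E : Type) (A : listAlgebra E) (e : E) : A -> A :=
  fun x => op (e, x).

Definition invariant_subclass (E : Type) (A : listAlgebra E) (X0 : set A) : Prop :=
  forall e : E, op_at e @` X0 `<=` X0.

Definition minimal (E : Type) (A : listAlgebra E) : Prop :=
  forall X0 : set A, invariant_subclass X0 -> X0 (base A) -> X0 = setT.

Definition unambiguous (E : Type) (A : listAlgebra E) : Prop :=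
  [/\ forall e : E, injective (@op_at E A e),
      trivIset setT (fun e : E => range (@op_at E A e))
    & ~ (\bigcup_(e : E) range (@op_at E A e)) (base A)].

Definition is_morphism (E : Type) (A B : listAlgebra E) (pi : A -> B) : Prop :=
  pi (base A) = base B /\
  forall e : E, @op_at E B e \o pi = pi \o @op_at E A e.

Definition initial (E : Type) (A : listAlgebra E) : Prop :=
  forall B : listAlgebra E, exists! pi : A -> B, is_morphism pi.

(* Main.v *)
Require Import Defs.
From mathcomp Require Import all_boot.
From mathcomp Require Import boolp classical_sets.

(** The finite sequences over [E], with [cons] as operation and the empty
    sequence as base point, are the model of an initial list algebra. Every list
    algebra [A] receives from them the morphism [eval A], which sends
    [:: e1; ...; en] to [f_e1 (... (f_en x0))], and it receives no other morphism
    from them, by induction on sequences. The theorem holds because each of its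
    two sides says that [eval A] is bijective.

    Initial objects are unique up to isomorphism, so [A] is initial exactly when
    the canonical map [eval A] from the sequences is bijective ([initialP]).
    On the other side, the range of [eval A] is the least invariant subclass
    containing the base point, so minimality is surjectivity ([minimalP]).
    Unambiguity lets one recover from [eval A s] whether [s] is empty and, if it
    is not, its head and the value of its tail; hence it makes [eval A]
    injective ([unambiguous_eval_inj]). Conversely sequences are unambiguous, and
    a bijective [eval A] transports this to [A] ([eval_bij_unambiguous]). *)

Set Implicit Arguments.
Unset Strict Implicit.
Unset Printing Implicit Defensive.

Local Open Scope classical_set_scope.

Section Evaluation.
Variable E : Type.
Implicit Types A B : listAlgebra E.

Definition seqAlgebra : listAlgebra E :=
  @ListAlgebra E (seq E) (fun p => p.1 :: p.2) [::].

Definition eval A (s : seq E) : A := foldr (@op_at E A) (base A) s.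

Lemma is_morphism_comp A B (C : listAlgebra E) (pi : A -> B) (rho : B -> C) :
  is_morphism pi -> is_morphism rho -> is_morphism (rho \o pi).
Proof.
move=> [pi0 piS] [rho0 rhoS]; split=> [|e]; first by rewrite /= pi0.
by rewrite compA rhoS -compA piS.
Qed.

Lemma is_morphism_id A : is_morphism (@id A).
Proof. by []. Qed.

Lemma is_morphism_eval A : @is_morphism E seqAlgebra A (eval A).
Proof. by []. Qed.

(** With [A := seqAlgebra], where [eval A] is the identity, this is the uniqueness
    half of the initiality of sequences; when [eval A] is onto, it gives uniqueness
    of the morphisms out of [A]. *)
Lemma morphism_eval A B (pi : A -> B) :
  is_morphism pi -> forall s, pi (eval A s) = eval B s.
Proof.
move=> [pi0 piS]; elim=> [|e s IHs] //=.
by rewrite -IHs; have /(congr1 (@^~ (eval A s))) /= <- := piS e.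
Qed.

Lemma eval_seqAlgebra s : eval seqAlgebra s = s.
Proof. by elim: s => //= e s ->. Qed.

Lemma eval_inv_op A (g : A -> seq E) :
  cancel (eval A) g -> cancel g (eval A) ->
  forall e x, g (op_at e x) = e :: g x.
Proof.
move=> evalK gK e x.
by rewrite -{1}[x]gK -[op_at _ _]/(eval A (e :: g x)) evalK.
Qed.

(** If [A] is initial, the inverse of [eval A] is the morphism from [A] to the
    sequences; if [eval A] has an inverse [g], then [eval B \o g] is the morphism
    from [A] to [B]. *)
Lemma initialP A : initial A <-> bijective (eval A).
Proof.
split=> [iniA|[g evalK gK] B].
  have [phi [phi_mor _]] := iniA seqAlgebra.
  exists phi => [s|x].
    by rewrite (morphism_eval phi_mor) eval_seqAlgebra.
  (* Both [eval A \o phi] and the identity are endomorphisms of [A]. *)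
  have [pi [_ pi_uniq]] := iniA A.
  have idE := pi_uniq _ (is_morphism_id A).
  have compE := pi_uniq _ (is_morphism_comp phi_mor (is_morphism_eval A)).
  by rewrite -[LHS]/((eval A \o phi) x) -compE idE.
exists (eval B \o g); split.
  split=> [|e]; first by rewrite /= -[base A]/(eval A [::]) evalK.
  by apply/funext => x; rewrite /= (eval_inv_op evalK gK).
by move=> pi pi_mor; apply/funext => x; rewrite -[x in RHS]gK (morphism_eval pi_mor).
Qed.

(** The values of sequences form an invariant subclass containing the base point,
    and by induction on sequences every such subclass contains them. *)
Lemma minimalP A : minimal A <-> forall x, exists s, eval A s = x.
Proof.
split=> [minA x|surj X0 invX0 X0base].
  suff : range (eval A) x by case=> s _ <-; exists s.
  rewrite (minA (range (eval A))) //; last by exists [::].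
  by move=> e _ [_ [s _ <-] <-]; exists (e :: s).
rewrite -subTset => x _; have [s <-] := surj x.
by elim: s => // e s IHs; apply: (invX0 e); exists (eval A s).
Qed.

(** Induction on the first sequence: the base point is outside all ranges, which
    settles the empty case; disjointness of the ranges equates the heads, and
    injectivity of the common operation the values of the tails. *)
Lemma unambiguous_eval_inj A : unambiguous A -> injective (eval A).
Proof.
move=> [op_inj op_disj base_notin].
have base_neq e x : op_at e x <> base A.
  by move=> opE; apply: base_notin; exists e => //; exists x.
elim=> [|e s IHs] [|e' t] //= opE.
- by case: (base_neq e' (eval A t)).
- by case: (base_neq e (eval A s)).
have e_eq : e = e'.
  apply: (op_disj e e') => //; exists (op_at e (eval A s)).
  by split; [exists (eval A s) | exists (eval A t)].
by subst e'; congr cons; apply/IHs/(op_inj e).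
Qed.

(** An inverse [g] of [eval A] turns each operation [f_e] into [cons e] and the
    base point into the empty sequence, and constructors are injective and
    disjoint. *)
Lemma eval_bij_unambiguous A : bijective (eval A) -> unambiguous A.
Proof.
move=> [g evalK gK]; have g_op := eval_inv_op evalK gK.
split=> [e x y /(congr1 g)|e e' _ _ [_ [[x _ <-] [y _ /(congr1 g)]]]|].
- by rewrite !g_op => -[/(congr1 (eval A))]; rewrite !gK.
- by rewrite !g_op => -[].
- move=> [e _ [x _ /(congr1 g)]].
  by rewrite g_op -[base A]/(eval A [::]) evalK.
Qed.

Lemma inj_surj_bijective (T U : Type) (f : T -> U) :
  injective f -> (forall y, exists x, f x = y) -> bijective f.
Proof.
move=> f_inj /choice [g gK]; exists g => // x.
by apply: f_inj; rewrite gK.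
Qed.

End Evaluation.

Theorem theorem13p2 (E : Type) (A : listAlgebra E) :
  initial A <-> minimal A /\ unambiguous A.
Proof.
rewrite initialP minimalP; split=> [eval_bij|[eval_surj unambA]].
  split; last exact: eval_bij_unambiguous.
  by have [g _ gK] := eval_bij => x; exists (g x).
exact: inj_surj_bijective (unambiguous_eval_inj unambA) eval_surj.
Qed.
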